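(* Consider an access to $s$ by a minimally self-adjusting BST algorithm, with tree $T$ before the access, tree $T'$ after the access, and search path $P$. Suppose the elements of $P$ are partitioned into at most $k$ subtree-disjoint sets $D_1,\dots,D_k$ and at most $\ell$ monotone sets $M_1,\dots,M_\ell$. Then \[\sum_{i\le k}|D_i|\le \Phi_T(P)-\Phi_{T'}(P)+2k+(8k+\ell)\log_2\frac{W}{w(s)}.\]
   Context: Keys are $[n]$. For a BST $T$ and node $a$, $T(a)$ is the set of keys in the subtree of $T$ rooted at $a$. Weights $w:[n]\to\mathbb{R}_{>0}$, $w(S)=\sum_{a\in S}w(a)$, $W=w([n])$. For $X\subseteq[n]$, $\Phi_T(X)=\sum_{a\in X}\log_2 w(T(a))$. A minimally self-adjusting BST algorithm, on access to $s$ in $T$ with search path $P$ (nodes on the root-to-$s$ path, including $s$), replaces $P$ by a BST $A$ on node set $P$ with root $s$ (the after-tree), reattaching the subtrees hanging off $P$ in the unique order-consistent way, to give $T'$. A subset $X\subseteq P$ is subtree-disjoint if $T'(a)\cap T'(a')=\emptyset$ for all $a\neq a'$ in $X$. A subset $X\subseteq P$ is monotone if either all elements of $X$ are larger than $s$ and have the same right-depth in $A$, or all are smaller than $s$ and have the same left-depth in $A$ (right-/left-depth: number of right-/left-going edges on the root-to-node path). *)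

(* Defs.v *)
From mathcomp Require Import all_boot all_order all_algebra.
From mathcomp Require Import reals exp.
Set Implicit Arguments.
Unset Strict Implicit.
Unset Printing Implicit Defensive.
Import Order.TTheory GRing.Theory Num.Theory.
Local Open Scope ring_scope.

(* The key set [n] is 'I_n, ordered as the naturals. *)
Inductive tree (n : nat) : Type :=
  | Leaf
  | Node of tree n & 'I_n & tree n.
Arguments Leaf {n}.

Section Trees.
Variable n : nat.
Implicit Types (t A : tree n) (s a x : 'I_n) (X : {set 'I_n}).

Fixpoint keys t : {set 'I_n} :=
  if t is Node l x r then x |: (keys l :|: keys r) else set0.

Fixpoint search_tree t : bool :=
  if t is Node l x r then
    [&& search_tree l, search_tree r,
        [forall a in keys l, (a < x)%N] & [forall a in keys r, (x < a)%N]]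
  else true.

Definition bst_on X t : bool := search_tree t && (keys t == X).

Definition root_key t : option 'I_n := if t is Node _ x _ then Some x else None.

(* Descends by comparing keys; meaningful on search trees containing a, as are
   all the key-directed functions below. *)
Fixpoint subtree t a : tree n :=
  if t is Node l x r then
    if a == x then t else if (a < x)%N then subtree l a else subtree r a
  else Leaf.

Definition subtree_keys t a : {set 'I_n} := keys (subtree t a).

Fixpoint search_path t s : {set 'I_n} :=
  if t is Node l x r then
    x |: (if s == x then set0
          else if (s < x)%N then search_path l s else search_path r s)
  else set0.

(* The subtrees (possibly empty) hanging off the search path of s, from left to
   right; there is one more of them than there are nodes on the path. *)
Fixpoint hanging t s : seq (tree n) :=
  if t is Node l x r then
    if s == x then [:: l; r]
    else if (s < x)%N then rcons (hanging l s) r else l :: hanging r s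
  else [:: Leaf].

Fixpoint leaves t : nat :=
  if t is Node l _ r then (leaves l + leaves r)%N else 1%N.

(* The leaves of A, from left to right, are replaced by the trees of ts. *)
Fixpoint graft A (ts : seq (tree n)) : tree n :=
  if A is Node l x r then
    Node (graft l (take (leaves l) ts)) x (graft r (drop (leaves l) ts))
  else head Leaf ts.

(* The search path of s in t is replaced by the after-tree A.  Filling the
   leaves of A from left to right with the hanging subtrees, themselves taken
   from left to right, is the only way to attach them that preserves the order
   of the keys. *)
Definition replace_path t s A : tree n := graft A (hanging t s).

Definition after_tree t s A : Prop :=
  bst_on (search_path t s) A /\ root_key A = Some s.

(* An algorithm is represented by the after-tree it chooses for each tree on
   [n] and each accessed key. *)
Definition minimally_self_adjusting (alg : tree n -> 'I_n -> tree n) : Prop :=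
  forall t s, bst_on [set: 'I_n] t -> after_tree t s (alg t s).

Fixpoint right_depth t a : nat :=
  if t is Node l x r then
    if a == x then 0%N
    else if (a < x)%N then right_depth l a else (right_depth r a).+1
  else 0%N.

Fixpoint left_depth t a : nat :=
  if t is Node l x r then
    if a == x then 0%N
    else if (a < x)%N then (left_depth l a).+1 else left_depth r a
  else 0%N.

(* t' is the tree after the access. *)
Definition subtree_disjoint t' X : Prop :=
  forall a b, a \in X -> b \in X -> a != b ->
    [disjoint subtree_keys t' a & subtree_keys t' b].

Definition monotone_set s A X : Prop :=
  ((forall a, a \in X -> (s < a)%N) /\
   (forall a b, a \in X -> b \in X -> right_depth A a = right_depth A b)) \/
  ((forall a, a \in X -> (a < s)%N) /\
   (forall a b, a \in X -> b \in X -> left_depth A a = left_depth A b)).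

Section Potential.
Variable R : realType.

Definition log2 (x : R) : R := ln x / ln 2.

Definition weight (w : 'I_n -> R) X : R := \sum_(a in X) w a.

Definition potential (w : 'I_n -> R) t X : R :=
  \sum_(a in X) log2 (weight w (subtree_keys t a)).

End Potential.
End Trees.

(* Main.v *)
(* Let a_1, a_2, ... be the keys, in order of distance from s, of a set X lying
   on one side of s.  If a_(i+1) is not in T'(a_i), then T'(a_i) is contained in
   T(a_(i+1)) minus s, since T(a_(i+1)) is an interval of keys containing s.
   When X is subtree-disjoint, Z_i = w(s) + sum_(j <= i) w(T'(a_j)) therefore
   satisfies Z_(i-1) <= w(T(a_i)), and
     1 <= log2 (w(T(a_i)) / w(T'(a_i))) + 2 log2 (Z_i / Z_(i-1)),
   because 2 y z <= (z + y)^2; the last term telescopes to at most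
   2 log2 (W / w(s)).  When X is monotone, w(T'(a_i)) <= w(T(a_(i+1)))
   telescopes directly.  That T' is again a search tree with the keys of T
   follows from the equality of the inorder traversals. *)
Require Import Defs.
From mathcomp Require Import all_boot all_order all_algebra.
From mathcomp Require Import reals exp.
From mathcomp Require Import lra zify.
Import Order.TTheory GRing.Theory Num.Theory.
Local Open Scope ring_scope.

(** * Inorder traversals, path replacement, and the geometry of subtrees *)

Section SearchTrees.
Variable n : nat.
Implicit Types (t l r A : tree n) (s a b c x : 'I_n) (xs ys : seq 'I_n).

Fixpoint inorder t : seq 'I_n :=
  if t is Node l x r then inorder l ++ x :: inorder r else [::].

Lemma mem_inorder t x : (x \in inorder t) = (x \in keys t).
Proof.
elim: t => [|l IHl y r IHr] /=; first by rewrite inE.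
by rewrite mem_cat !inE IHl IHr orbCA.
Qed.

Lemma leaves_inorder t : leaves t = (size (inorder t)).+1.
Proof.
by elim: t => [|l IHl y r IHr] //=; rewrite size_cat /= IHl IHr; lia.
Qed.

Lemma search_tree_sorted t : search_tree t = sorted (relpre val ltn) (inorder t).
Proof.
have tr : transitive (relpre (val : 'I_n -> nat) ltn).
  by move=> b a c /=; exact: ltn_trans.
elim: t => [|l IHl y r IHr] //=.
rewrite IHl IHr !(sorted_pairwise tr) pairwise_cat /= allrel_consr.
have -> : [forall (a | a \in keys l), (a < y)%N]
          = all (fun a => relpre val ltn a y) (inorder l).
  apply/forall_inP/allP => H a; first by rewrite mem_inorder => /H.
  by rewrite -mem_inorder => /H.
have -> : [forall (a | a \in keys r), (y < a)%N]
          = all (relpre val ltn y) (inorder r).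
  apply/forall_inP/allP => H a; first by rewrite mem_inorder => /H.
  by rewrite -mem_inorder => /H.
apply/and4P/and4P => [[-> -> Hl Hr]|]; last first.
  by case=> /andP[Hl _] -> Hr ->.
(* [search_tree] does not compare left keys with right keys directly; these cross pairs follow by
   transitivity through the root [y]. *)
split=> //; rewrite Hl /=; apply/allrelP => a b ha hb.
by apply: (tr y); [exact: (allP Hl)|exact: (allP Hr)].
Qed.

(* The inorder traversal of any tree with inner nodes xs and the trees ts at
   its leaves. *)
Fixpoint weave xs (ts : seq (tree n)) : seq 'I_n :=
  if xs is x :: xs' then inorder (head Leaf ts) ++ x :: weave xs' (behead ts)
  else inorder (head Leaf ts).

(** A tree with [size xs] inner nodes has one more leaf, whence the cut at [(size xs).+1]. The
    default [Leaf] makes the identity hold for [ts] of any length. *)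
Lemma weave_cat xs x ys ts :
  weave (xs ++ x :: ys) ts =
  weave xs (take (size xs).+1 ts) ++ x :: weave ys (drop (size xs).+1 ts).
Proof.
elim: xs ts => [|z xs IH] [|t ts] //=; rewrite ?take0 ?drop0 //.
  by rewrite IH.
by rewrite IH -catA.
Qed.

Lemma inorder_graft A ts : inorder (graft A ts) = weave (inorder A) ts.
Proof.
elim: A ts => [|l IHl x r IHr] ts //=.
by rewrite weave_cat IHl IHr leaves_inorder.
Qed.

(** The path is listed in key order, not from the root down, so that it interleaves with [hanging]
    and can be compared with the inorder traversal of an after-tree. *)
Fixpoint path_seq t s : seq 'I_n :=
  if t is Node l x r then
    if s == x then [:: x]
    else if (s < x)%N then rcons (path_seq l s) x else x :: path_seq r s
  else [::].

Lemma mem_path_seq t s x : (x \in path_seq t s) = (x \in search_path t s).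
Proof.
elim: t => [|l IHl y r IHr] /=; first by rewrite inE.
rewrite !inE; case: eqP => _; first by rewrite inE inE orbF.
by case: ifP => _; rewrite ?mem_rcons inE ?IHl ?IHr.
Qed.

Lemma size_hanging t s : size (hanging t s) = (size (path_seq t s)).+1.
Proof.
elim: t => [|l IHl y r IHr] //=.
by case: ifP => // _; case: ifP => _; rewrite ?size_rcons /= ?IHl ?IHr.
Qed.

Lemma subseq_path_seq t s : subseq (path_seq t s) (inorder t).
Proof.
elim: t => [|l IHl y r IHr] //=.
case: eqP => _; first by rewrite sub1seq mem_cat inE eqxx orbT.
case: ifP => _.
  rewrite -cats1; apply: cat_subseq => //.
  by rewrite sub1seq inE eqxx.
rewrite -[y :: path_seq r s]cat0s; apply: cat_subseq; first exact: sub0seq.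
by rewrite /= eqxx.
Qed.

Lemma weave_path_seq t s : weave (path_seq t s) (hanging t s) = inorder t.
Proof.
elim: t => [|l IHl y r IHr] //=.
case: eqP => _ //; case: ifP => _ /=; last by rewrite IHr.
(* By [size_hanging] the cut falls exactly after [hanging l s], so the tree left over for the part
   after [y] is [r]. *)
rewrite -!cats1 weave_cat -size_hanging take_size_cat // drop_size_cat //=.
by rewrite IHl.
Qed.

(** [inorder A] and [path_seq t s] are strictly sorted with the same elements, hence equal, and
    weaving the latter with the hanging trees gives [inorder t]. *)
Lemma inorder_replace_path t s A :
  search_tree t -> bst_on (search_path t s) A ->
  inorder (replace_path t s A) = inorder t.
Proof.
move=> st /andP[sA /eqP kA].
rewrite /replace_path inorder_graft -[RHS](weave_path_seq t s); congr weave.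
have tr : transitive (relpre (val : 'I_n -> nat) ltn).
  by move=> b a c /=; exact: ltn_trans.
apply: (irr_sorted_eq tr).
- by move=> a /=; exact: ltnn.
- by rewrite -search_tree_sorted.
- apply: (subseq_sorted tr (subseq_path_seq t s)).
  by rewrite -search_tree_sorted.
- by move=> a; rewrite mem_inorder kA mem_path_seq.
Qed.

Lemma bst_replace_path X t s A :
  bst_on X t -> bst_on (search_path t s) A -> bst_on X (replace_path t s A).
Proof.
move=> /andP[st /eqP kt] bA; have E := inorder_replace_path _ _ _ st bA.
rewrite /bst_on search_tree_sorted E -search_tree_sorted st /=.
by apply/eqP/setP => a; rewrite -mem_inorder E mem_inorder kt.
Qed.

(** One case analysis decides both comparisons at a node and refutes the membership on the wrong
    side; for [a = x] the memberships are left as they stand. *)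
Variant node_spec l x r a : bool -> bool -> bool -> bool -> Prop :=
| NodeEq of a = x : node_spec l x r a true false (a \in keys l) (a \in keys r)
| NodeLt of (a < x)%N : node_spec l x r a false true (a \in keys l) false
| NodeGt of (x < a)%N : node_spec l x r a false false false (a \in keys r).

Lemma nodeP l x r a : search_tree (Node l x r) ->
  node_spec l x r a (a == x) (a < x)%N (a \in keys l) (a \in keys r).
Proof.
case/and4P=> _ _ /forall_inP hl /forall_inP hr.
case: (ltngtP a x) => [ax|xa|/val_inj ->]; last first.
- by rewrite eqxx; constructor.
- have -> : (a \in keys l) = false.
    by apply/negP => /hl; rewrite ltnNge ltnW.
  by rewrite -val_eqE gtn_eqF //; constructor.
- have -> : (a \in keys r) = false.
    by apply/negP => /hr; rewrite ltnNge ltnW.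
  by rewrite -val_eqE ltn_eqF //; constructor.
Qed.

Lemma subtree_keys_sub t a : subtree_keys t a \subset keys t.
Proof.
rewrite /subtree_keys; elim: t => [|l IHl x r IHr] //=.
case: ifP => // _; case: ifP => _.
  by apply: subset_trans IHl _; apply/subsetP => b; rewrite !inE => ->; rewrite orbT.
by apply: subset_trans IHr _; apply/subsetP => b; rewrite !inE => ->; rewrite !orbT.
Qed.

Lemma search_path_sub t s : search_path t s \subset keys t.
Proof.
by apply/subsetP => a; rewrite -mem_path_seq -mem_inorder;
  apply: mem_subseq; exact: subseq_path_seq.
Qed.

Lemma mem_subtree_keys t a :
  search_tree t -> a \in keys t -> a \in subtree_keys t a.
Proof.
rewrite /subtree_keys; elim: t => [|l IHl x r IHr] //= st.
have /and4P[sl sr _ _] := st.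
rewrite !inE; case: (nodeP _ _ _ a st) => //=.
- by move=> ->; rewrite !inE eqxx.
- by rewrite orbF => _; exact: IHl.
- by move=> _; exact: IHr.
Qed.

(** Each step of the descent towards [a] enters one child. It holds [b] and [c], so [x] lies on the
    same side of the node and, being a key, in that child. *)
Lemma subtree_keys_convex t a b c x :
  search_tree t -> b \in subtree_keys t a -> c \in subtree_keys t a ->
  (b <= x <= c)%N -> x \in keys t -> x \in subtree_keys t a.
Proof.
rewrite /subtree_keys; elim: t => [|l IHl y r IHr] //= st.
have /and4P[sl sr /forall_inP hl /forall_inP hr] := st.
case: ifP => // _; case: ifP => _ bt ct bxc; rewrite !inE.
- have cy : (c < y)%N by apply/hl/(subsetP (subtree_keys_sub l a)).
  case: (nodeP _ _ _ x st) => /= [|_|]; last lia.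
    by move=> E; move: bxc; rewrite E; lia.
  by rewrite orbF; exact: IHl.
- have yb : (y < b)%N by apply/hr/(subsetP (subtree_keys_sub r a)).
  case: (nodeP _ _ _ x st) => /= [||_]; last exact: IHr.
    by move=> E; move: bxc; rewrite E; lia.
  by lia.
Qed.

Lemma search_path_subtree t s a :
  search_tree t -> s \in keys t -> a \in search_path t s ->
  s \in subtree_keys t a.
Proof.
rewrite /subtree_keys; elim: t => [|l IHl x r IHr] //= st.
have /and4P[sl sr /forall_inP hl /forall_inP hr] := st.
rewrite !inE; case: (nodeP _ _ _ s st) => /= [->|sx|xs].
- by rewrite inE orbF => _ ->; rewrite !inE eqxx.
- rewrite orbF => skl /orP[->|ap]; first by rewrite !inE skl orbT.
  have ax : (a < x)%N by apply/hl/(subsetP (search_path_sub l s)).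
  by rewrite -val_eqE ltn_eqF //= ax IHl.
- move=> skr /orP[->|ap]; first by rewrite !inE skr !orbT.
  have xa : (x < a)%N by apply/hr/(subsetP (search_path_sub r s)).
  by rewrite -val_eqE gtn_eqF //= [(a < x)%N]ltnNge (ltnW xa) /= IHr.
Qed.

Lemma root_notin_subtree l s r a :
  search_tree (Node l s r) -> a != s -> s \notin subtree_keys (Node l s r) a.
Proof.
move=> /and4P[_ _ /forall_inP hl /forall_inP hr].
rewrite /subtree_keys /= => /negbTE ->.
case: ifP => _; apply/negP => /(subsetP (subtree_keys_sub _ _)).
  by move/hl; rewrite ltnn.
by move/hr; rewrite ltnn.
Qed.

(** Grafting changes nothing above the leaves of [A]; this carries the depths that define monotone
    sets over to the tree after the access. *)
Lemma right_depth_graft A ts a : search_tree A -> a \in keys A ->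
  right_depth (graft A ts) a = right_depth A a.
Proof.
elim: A ts => [|l IHl x r IHr] ts /=; first by rewrite inE.
move=> st; have /and4P[sl sr _ _] := st.
rewrite !inE; case: (nodeP _ _ _ a st) => //= _.
- by rewrite orbF; exact: IHl.
- by move=> ?; rewrite IHr.
Qed.

Lemma left_depth_graft A ts a : search_tree A -> a \in keys A ->
  left_depth (graft A ts) a = left_depth A a.
Proof.
elim: A ts => [|l IHl x r IHr] ts /=; first by rewrite inE.
move=> st; have /and4P[sl sr _ _] := st.
rewrite !inE; case: (nodeP _ _ _ a st) => //= _.
- by rewrite orbF => ?; rewrite IHl.
- exact: IHr.
Qed.

(** The way from [b] down to a larger key leaves [b] by a right edge. So of two keys of equal
    right-depth, the larger is never in the subtree of the smaller. *)
Lemma right_depth_subtree t a b : search_tree t ->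
  a \in subtree_keys t b -> (b < a)%N -> (right_depth t b < right_depth t a)%N.
Proof.
rewrite /subtree_keys; elim: t => [|l IHl x r IHr] /=; first by rewrite inE.
move=> st; have /and4P[sl sr /forall_inP hl /forall_inP hr] := st.
case: eqP => [-> _ xa|_].
  by rewrite -val_eqE gtn_eqF //= [(a < x)%N]ltnNge (ltnW xa).
case: ifP => _ H ba.
  have ax : (a < x)%N by apply/hl/(subsetP (subtree_keys_sub l b)).
  by rewrite -val_eqE ltn_eqF //= ax IHl.
have xa : (x < a)%N by apply/hr/(subsetP (subtree_keys_sub r b)).
by rewrite -val_eqE gtn_eqF //= [(a < x)%N]ltnNge (ltnW xa) /= ltnS IHr.
Qed.

Lemma left_depth_subtree t a b : search_tree t ->
  a \in subtree_keys t b -> (a < b)%N -> (left_depth t b < left_depth t a)%N.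
Proof.
rewrite /subtree_keys; elim: t => [|l IHl x r IHr] /=; first by rewrite inE.
move=> st; have /and4P[sl sr /forall_inP hl /forall_inP hr] := st.
case: eqP => [-> _ ax|_].
  by rewrite -val_eqE ltn_eqF //= ax.
case: ifP => _ H ab.
  have ax : (a < x)%N by apply/hl/(subsetP (subtree_keys_sub l b)).
  by rewrite -val_eqE ltn_eqF //= ax ltnS IHl.
have xa : (x < a)%N by apply/hr/(subsetP (subtree_keys_sub r b)).
by rewrite -val_eqE gtn_eqF //= [(a < x)%N]ltnNge (ltnW xa) /= IHr.
Qed.

(* Subtrees are intervals of keys, and b lies between s and a. *)
Lemma subtree_keys_transfer t t' s a b :
  bst_on [set: 'I_n] t -> bst_on [set: 'I_n] t' -> a \in search_path t s ->
  s \notin subtree_keys t' b -> a \notin subtree_keys t' b ->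
  (s < b < a)%N || (a < b < s)%N ->
  subtree_keys t' b \subset subtree_keys t a :\ s.
Proof.
move=> /andP[st /eqP kt] /andP[st' /eqP kt'] ap snb anb ord.
have bb : b \in subtree_keys t' b by apply: mem_subtree_keys; rewrite ?kt' ?inE.
have aa : a \in subtree_keys t a by apply: mem_subtree_keys; rewrite ?kt ?inE.
have sa : s \in subtree_keys t a by apply: search_path_subtree; rewrite ?kt ?inE.
apply/subsetP => c cb; rewrite !inE; apply/andP; split.
  by apply: contraNneq snb => <-.
(* No key outside the subtree of [b] separates [b] from [c]; used for [s] and [a], this places [c]
   between them. *)
have between x : x \notin subtree_keys t' b -> ~~ (b <= x <= c)%N && ~~ (c <= x <= b)%N.
  move=> xn; apply/andP; split; apply: contra xn => H;
    by [apply: (subtree_keys_convex _ _ b c) H _; rewrite ?kt' ?inE |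
        apply: (subtree_keys_convex _ _ c b) H _; rewrite ?kt' ?inE].
have /andP[s1 s2] := between _ snb; have /andP[a1 a2] := between _ anb.
case/orP: ord => ord.
  apply: (subtree_keys_convex _ _ s a) => //; [lia|by rewrite kt inE].
apply: (subtree_keys_convex _ _ a s) => //; [lia|by rewrite kt inE].
Qed.

End SearchTrees.

(** Elements are added in increasing order of [f]; injectivity puts the maximum strictly above the
    rest. *)
Lemma set_max_ind (I : finType) (f : I -> nat) (Q : {set I} -> Prop) :
  injective f -> Q set0 ->
  (forall m (X : {set I}), (forall a, a \in X -> (f a < f m)%N) -> Q X -> Q (m |: X)) ->
  forall X, Q X.
Proof.
move=> fI Q0 QS X; have [k] := ubnP #|X|.
elim: k X => // k IH X; case: (set_0Vmem X) => [-> //|[i0 Xi0]] cX.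
case: (arg_maxnP f Xi0) => m Xm mmax; have {}Xm : m \in X := Xm.
rewrite -(setD1K Xm); apply: QS => [a|]; last first.
  by apply: IH; move: cX; rewrite (cardsD1 m) Xm.
rewrite !inE => /andP[am Xa]; rewrite ltn_neqAle (mmax a Xa : (f a <= f m)%N) andbT.
by apply: contra am => /eqP/fI ->.
Qed.

(** * Logarithmic inequalities for ranked finite families *)

Section Logarithms.
Variable R : realType.
Implicit Types x y z c : R.

Lemma ln2_gt0 : 0 < ln 2 :> R.
Proof. by rewrite ln_gt0 // ltr1n. Qed.

Lemma log2_2 : log2 (2 : R) = 1.
Proof. by rewrite /log2 divff // gt_eqF // ln2_gt0. Qed.

Lemma log2M x y : 0 < x -> 0 < y -> log2 (x * y) = log2 x + log2 y.
Proof. by move=> x0 y0; rewrite /log2 lnM ?posrE // mulrDl. Qed.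

Lemma log2_div x y : 0 < x -> 0 < y -> log2 (x / y) = log2 x - log2 y.
Proof. by move=> x0 y0; rewrite /log2 ln_div ?posrE // mulrBl. Qed.

Lemma ler_log2 x y : 0 < x -> x <= y -> log2 x <= log2 y.
Proof.
move=> x0 xy; rewrite /log2 ler_pM2r ?invr_gt0 ?ln2_gt0 //.
by rewrite ler_ln // posrE // (lt_le_trans x0).
Qed.

(** Take logarithms in [2 * (y * z) <= (z + y) ^ 2], then bound one [log2 z] by [log2 x]. *)
Lemma log2_step z y x : 0 < z -> 0 < y -> z <= x ->
  1 <= log2 x - log2 y + 2 * (log2 (z + y) - log2 z).
Proof.
move=> z0 y0 zx.
have zy0 : 0 < z + y by rewrite addr_gt0.
have : log2 (2 * (y * z)) <= log2 ((z + y) * (z + y)).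
  by apply: ler_log2; [rewrite !mulr_gt0|nra].
rewrite !log2M ?mulr_gt0 // log2_2.
by have := ler_log2 _ _ z0 zx; lra.
Qed.

Variables (I : finType) (f : I -> nat) (x y : I -> R) (c : R).
Hypotheses (f_inj : injective f) (c_gt0 : 0 < c).

(** In the application [f] ranks keys by distance from the accessed key, [c] is its weight, and [x],
    [y] are subtree weights before and after the access. The maximum [m] is charged by [log2_step]
    with [z = c + \sum_(a in X) y a], so the last term telescopes. *)
Lemma card_le_sum_log2 (X : {set I}) :
  (forall a, a \in X -> 0 < y a) ->
  (forall a, a \in X -> c + \sum_(b in X | (f b < f a)%N) y b <= x a) ->
  #|X|%:R <= \sum_(a in X) log2 (x a) - \sum_(a in X) log2 (y a)
             + 2 * (log2 (c + \sum_(a in X) y a) - log2 c).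
Proof.
move: X; apply: (set_max_ind I f _ f_inj) => [|m X ltm IH] y0 hx.
  by rewrite cards0 !big_set0 addr0 !subrr mulr0 addr0.
have mX : m \notin X by apply/negP => /ltm; rewrite ltnn.
have y0X a : a \in X -> 0 < y a by move=> aX; apply: y0; rewrite !inE aX orbT.
have sum0 : 0 <= \sum_(a in X) y a by apply: sumr_ge0 => a /y0X/ltW.
have {}IH := IH y0X.
rewrite cardsU1 mX natrD !big_setU1 //=.
have hm : c + \sum_(a in X) y a <= x m.
  have mS : m \in m |: X by rewrite !inE eqxx.
  apply: le_trans (hx _ mS); rewrite lerD2l le_eqVlt; apply/orP; left.
  apply/eqP/eq_bigl => b; rewrite !inE; case: eqP => [->|_] /=.
    by rewrite ltnn (negbTE mX).
  by case bX: (b \in X) => //=; rewrite ltm.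
have := log2_step _ _ _ (ltr_wpDr sum0 c_gt0) (y0 m (setU11 _ _)) hm.
rewrite [y m + _]addrC [c + (_ + _)]addrA.
suff /IH : forall a, a \in X -> c + \sum_(b in X | (f b < f a)%N) y b <= x a by lra.
(* Adding [m] leaves the partial sums of the other elements unchanged, since [f m] exceeds their
   ranks. *)
move=> a aX; apply: le_trans (hx a _); last by rewrite !inE aX orbT.
rewrite lerD2l le_eqVlt; apply/orP; left; apply/eqP/eq_bigl => b.
rewrite !inE; case: eqP => [->|_] //=.
by rewrite (negbTE mX) ltnNge ltnW // ltm.
Qed.

(** The bound [z] varies in the induction: it pays for [y m], and [x m] then becomes the bound for
    the remaining elements. *)
Lemma sum_log2_monotone (X : {set I}) z : c <= z ->
  (forall a, a \in X -> c <= x a) -> (forall a, a \in X -> 0 < y a <= z) ->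
  (forall a b, a \in X -> b \in X -> (f b < f a)%N -> y b <= x a) ->
  \sum_(a in X) log2 (y a) - \sum_(a in X) log2 (x a)
    <= log2 z - log2 c.
Proof.
move: X z; apply: (set_max_ind I f _ f_inj) => [|m X ltm IH] z cz cx yz yx.
  by rewrite !big_set0 subrr subr_ge0 ler_log2.
have mX : m \notin X by apply/negP => /ltm; rewrite ltnn.
have Xm a : a \in X -> a \in m |: X by move=> aX; rewrite !inE aX orbT.
rewrite !big_setU1 //=.
have /andP[ym0 ymz] := yz m (setU11 _ _).
have := ler_log2 _ _ ym0 ymz.
suff : \sum_(a in X) log2 (y a) - \sum_(a in X) log2 (x a)
       <= log2 (x m) - log2 c by lra.
apply: IH => [|a aX|a aX|a b aX bX].
- by apply: cx; rewrite setU11.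
- exact/cx/Xm.
- have /andP[-> _] := yz a (Xm _ aX) => /=.
  by apply: yx; rewrite ?setU11 ?Xm ?ltm.
- by apply: yx; exact: Xm.
Qed.

End Logarithms.

(** * Potential bounds for one access *)

Section Access.
Variables (R : realType) (n : nat) (w : 'I_n -> R).
Hypothesis w_gt0 : forall a, 0 < w a.
Implicit Types (a b s : 'I_n) (X Y : {set 'I_n}) (t : tree n).

Lemma weight_sub X Y : X \subset Y -> weight w X <= weight w Y.
Proof.
move=> XY; rewrite /weight [leRHS](big_setID X) /= (setIidPr XY) lerDl.
by apply: sumr_ge0 => a _; exact: ltW.
Qed.

Lemma le_weight a X : a \in X -> w a <= weight w X.
Proof.
move=> aX; rewrite /weight (big_setD1 a aX) lerDl.
by apply: sumr_ge0 => b _; exact: ltW.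
Qed.

Lemma weight_disjoint_le (Q : pred 'I_n) (F : 'I_n -> {set 'I_n}) s X :
  s \in X -> (forall a, Q a -> F a \subset X :\ s) ->
  (forall a b, Q a -> Q b -> a != b -> [disjoint F a & F b]) ->
  w s + \sum_(a | Q a) weight w (F a) <= weight w X.
Proof.
move=> sX FX dF; rewrite [leRHS](big_setD1 s sX) lerD2l /= /weight.
(* The formula for sums over disjoint unions asks for disjointness at all indices, so [F] is made
   empty outside [Q]. *)
pose G a := if Q a then F a else set0.
have -> : \sum_(a | Q a) \sum_(b in F a) w b = \sum_a \sum_(b in G a) w b.
  rewrite big_mkcond; apply: eq_bigr => a _.
  by rewrite /G; case: (Q a) => //; rewrite big_set0.
rewrite -(@partition_disjoint_bigcup _ _ _ _ _ G); last first.
  move=> a b ab; rewrite /G; case Qa: (Q a); last by rewrite disjoints_subset sub0set.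
  by case Qb: (Q b); [exact: dF | rewrite disjoint_sym disjoints_subset sub0set].
apply: weight_sub; apply/bigcupsP => a _.
by rewrite /G; case Qa: (Q a); [exact: FX | exact: sub0set].
Qed.

Variables (t t' : tree n) (s : 'I_n).
Hypotheses (bst_t : bst_on [set: 'I_n] t) (bst_t' : bst_on [set: 'I_n] t').
Hypothesis root_t' : root_key t' = Some s.

Lemma root_notin_subtree_keys a : a != s -> s \notin subtree_keys t' a.
Proof.
move: root_t' bst_t'; case: t' => //= l x r [->] /andP[st _].
exact: root_notin_subtree.
Qed.

Lemma weight_subtree_gt0 t0 a :
  bst_on [set: 'I_n] t0 -> 0 < weight w (subtree_keys t0 a).
Proof.
move=> /andP[st0 /eqP kt0]; apply: lt_le_trans (w_gt0 a) (le_weight _ _ _).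
by apply: mem_subtree_keys; rewrite ?kt0 ?inE.
Qed.

Lemma mem_path_subtree a : a \in search_path t s -> s \in subtree_keys t a.
Proof.
by move: bst_t => /andP[st /eqP kt]; apply: search_path_subtree; rewrite ?kt ?inE.
Qed.

Lemma log2_total_weight_ge0 : 0 <= log2 (weight w [set: 'I_n] / w s).
Proof.
have ws : w s <= weight w [set: 'I_n] by rewrite le_weight ?inE.
have W0 := lt_le_trans (w_gt0 s) ws.
by rewrite log2_div // subr_ge0 ler_log2.
Qed.

(** * Path keys on one side of the accessed key *)

Section OneSide.
Variables (f : 'I_n -> nat) (X : {set 'I_n}).
Hypothesis f_inj : injective f.
Hypothesis X_path : X \subset search_path t s.
(** [f] grows with the distance from [s]: it will be [val] on the right and [rev_key] on the
    left. *)
Hypothesis X_side : forall a b, a \in X -> b \in X -> (f b < f a)%N ->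
  (s < b < a)%N || (a < b < s)%N.
Hypothesis s_notin : s \notin X.

Let s_notin_subtree b : b \in X -> s \notin subtree_keys t' b.
Proof.
by move=> bX; apply: root_notin_subtree_keys; apply: contraNneq s_notin => <-.
Qed.

Lemma subtree_disjoint_side_card : subtree_disjoint t' X ->
  #|X|%:R <= potential w t X - potential w t' X
             + 2 * log2 (weight w [set: 'I_n] / w s).
Proof.
move=> dX.
have sumW : w s + \sum_(a in X) weight w (subtree_keys t' a)
            <= weight w [set: 'I_n].
  apply: weight_disjoint_le => [|a aX|a b]; [by rewrite inE| |exact: dX].
  by rewrite subsetD1 subsetT s_notin_subtree.
have := card_le_sum_log2 R _ f (fun a => weight w (subtree_keys t a))
  (fun a => weight w (subtree_keys t' a)) (w s) f_inj (w_gt0 s) X.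
move/(_ (fun a _ => weight_subtree_gt0 _ _ bst_t')).
have sum_ge0 : 0 <= \sum_(a in X) weight w (subtree_keys t' a).
  by apply: sumr_ge0 => a _; apply/ltW/weight_subtree_gt0.
have pos : 0 < w s + \sum_(a in X) weight w (subtree_keys t' a).
  by rewrite ltr_wpDr.
have := ler_log2 _ _ _ pos sumW.
rewrite log2_div ?(lt_le_trans pos sumW) // /potential => lW.
have step a : a \in X ->
    w s + \sum_(b in X | (f b < f a)%N) weight w (subtree_keys t' b)
    <= weight w (subtree_keys t a).
  move=> aX; have aP := subsetP X_path _ aX.
  apply: weight_disjoint_le => [|b /andP[bX ba]|b c /andP[bX _] /andP[cX _]].
  - exact: mem_path_subtree.
  - apply: subtree_keys_transfer => //; [exact: s_notin_subtree| |exact: X_side].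
    have ab : a != b by apply: contraTneq ba => ->; rewrite ltnn.
    rewrite (disjointFr (dX _ _ aX bX ab)) //.
    by move: bst_t' => /andP[st' /eqP kt']; apply: mem_subtree_keys; rewrite ?kt' ?inE.
  - exact: dX.
by move/(_ step); lra.
Qed.

(** Exclusion is asked in one direction only, as in a monotone set the nearer key may lie in the
    subtree of the farther one. It gives the inclusions that [sum_log2_monotone] telescopes from the
    total weight down to [w s]. *)
Lemma monotone_side_potential :
  (forall a b, a \in X -> b \in X -> (f b < f a)%N -> a \notin subtree_keys t' b) ->
  potential w t' X - potential w t X <= log2 (weight w [set: 'I_n] / w s).
Proof.
move=> mX; have ws : w s <= weight w [set: 'I_n] by rewrite le_weight ?inE.
rewrite log2_div ?(lt_le_trans (w_gt0 s) ws) //.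
apply: (sum_log2_monotone _ _ f (fun a => weight w (subtree_keys t a))
  (fun a => weight w (subtree_keys t' a)) (w s)) => // [a aX|a aX|a b aX bX ba].
- by apply/le_weight/mem_path_subtree/(subsetP X_path).
- by rewrite weight_subtree_gt0 // weight_sub // subsetT.
- apply/weight_sub/(subset_trans _ (subD1set _ s)).
  apply: subtree_keys_transfer => //; last exact: X_side.
  + exact: (subsetP X_path).
  + exact: s_notin_subtree.
  + exact: mX.
Qed.

End OneSide.

Let rev_key (a : 'I_n) : nat := (n - a)%N.

Let rev_key_inj : injective rev_key.
Proof.
move=> a b; rewrite /rev_key => E; apply: val_inj => /=.
by have := ltn_ord a; have := ltn_ord b; lia.
Qed.

(** Each side of [s] costs [2 * L] and [s] itself at most [2 + L]; as [L] is nonnegative, the total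
    [5 * L] is at most [8 * L]. *)
Lemma subtree_disjoint_card X :
  X \subset search_path t s -> subtree_disjoint t' X ->
  #|X|%:R <= potential w t X - potential w t' X + 2
             + 8 * log2 (weight w [set: 'I_n] / w s).
Proof.
move=> XP dX; set L := log2 _.
have L0 : 0 <= L := log2_total_weight_ge0.
pose X1 := [set a in X | (s < a)%N]; pose X2 := [set a in X | (a < s)%N].
have X1X : X1 \subset X by apply/subsetP => a; rewrite inE => /andP[].
have X2X : X2 \subset X by apply/subsetP => a; rewrite inE => /andP[].
have d1 : subtree_disjoint t' X1.
  by move=> a b /(subsetP X1X) aX /(subsetP X1X) bX; exact: dX.
have d2 : subtree_disjoint t' X2.
  by move=> a b /(subsetP X2X) aX /(subsetP X2X) bX; exact: dX.
have B1 : #|X1|%:R <= potential w t X1 - potential w t' X1 + 2 * L.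
  apply: (subtree_disjoint_side_card val) => //.
  - exact: val_inj.
  - exact: subset_trans XP.
  - by move=> a b; rewrite !inE => /andP[_ sa] /andP[_ sb] /= ->; rewrite sb.
  - by rewrite inE ltnn andbF.
have B2 : #|X2|%:R <= potential w t X2 - potential w t' X2 + 2 * L.
  apply: (subtree_disjoint_side_card rev_key) => //.
  - exact: subset_trans XP.
  - move=> a b; rewrite !inE /rev_key => /andP[_ sa] /andP[_ sb] ba.
    by apply/orP; right; lia.
  - by rewrite inE ltnn andbF.
have B0 : #|X :&: [set s]|%:R <=
    potential w t (X :&: [set s]) - potential w t' (X :&: [set s]) + 2 + L.
  have [sX|sX] := boolP (s \in X); last first.
    have -> : X :&: [set s] = set0.
      by apply/eqP; rewrite setI_eq0 disjoint_sym disjoints1.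
    by rewrite cards0 /potential !big_set0; lra.
  rewrite (setIidPr _) ?sub1set // cards1 /potential !big_set1 /L.
  (* The subtree of [s] weighs at least [w s] before the access and at most the total weight after
     it, so [L] covers any rise in its potential. *)
  have sT := le_weight _ _ (mem_path_subtree _ (subsetP XP _ sX)).
  have TW := weight_sub _ _ (subsetT (subtree_keys t' s)).
  have T0 := weight_subtree_gt0 t' s bst_t'.
  have := ler_log2 _ _ _ (w_gt0 s) sT; have := ler_log2 _ _ _ T0 TW.
  by rewrite log2_div ?(lt_le_trans T0 TW) //; lra.
have split (F : 'I_n -> R) : \sum_(a in X) F a =
    \sum_(a in X1) F a + \sum_(a in X2) F a + \sum_(a in X :&: [set s]) F a.
  rewrite (big_setID [set s]) /= addrC; congr (_ + _).
  rewrite (big_setID [set a : 'I_n | (s < a)%N]) /=.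
  congr (_ + _); apply: eq_bigl => a; rewrite !inE -val_eqE /=;
    by case: (a \in X); case: (ltngtP a s).
have card Y : #|Y|%:R = \sum_(a in Y) (1 : R) by rewrite sumr_const.
have -> : #|X|%:R = #|X1|%:R + #|X2|%:R + #|X :&: [set s]|%:R :> R.
  by rewrite !card split.
by move: B0 B1 B2; rewrite /potential !split; lra.
Qed.

Lemma monotone_potential A ts X :
  t' = graft A ts -> bst_on (search_path t s) A ->
  X \subset search_path t s -> monotone_set s A X ->
  potential w t' X - potential w t X <= log2 (weight w [set: 'I_n] / w s).
Proof.
move=> t'E /andP[sA /eqP kA] XP.
have st' : search_tree t' by case/andP: bst_t'.
have XA a : a \in X -> a \in keys A by rewrite kA; exact: (subsetP XP).
case=> [[Xs dep]|[Xs dep]].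
- apply: (monotone_side_potential val) => // [|a b aX bX||a b aX bX].
  + exact: val_inj.
  + by move=> /= ->; rewrite Xs.
  + by apply/negP => /Xs; rewrite ltnn.
  + move=> /= ba; apply/negP => /(right_depth_subtree _ _ _ _ st') /(_ ba).
    by rewrite t'E !right_depth_graft ?XA // (dep _ _ aX bX) ltnn.
- apply: (monotone_side_potential rev_key) => // [a b aX bX||a b aX bX].
  + by have := Xs _ bX; rewrite /rev_key => bs ba; apply/orP; right; lia.
  + by apply/negP => /Xs; rewrite ltnn.
  + rewrite /rev_key => ba; have {}ba : (a < b)%N by lia.
    apply/negP => /(left_depth_subtree _ _ _ _ st') /(_ ba).
    by rewrite t'E !left_depth_graft ?XA // (dep _ _ aX bX) ltnn.
Qed.

End Access.

(** * Summation over the partition of the search path *)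

Theorem theorem4 (R : realType) (n k l : nat) (w : 'I_n -> R)
    (alg : tree n -> 'I_n -> tree n) (T : tree n) (s : 'I_n)
    (D M : {set {set 'I_n}}) :
  let P := search_path T s in
  let A := alg T s in
  let T' := replace_path T s A in
  let W := weight w [set: 'I_n] in
  (forall a, 0 < w a) ->
  minimally_self_adjusting alg ->
  bst_on [set: 'I_n] T ->
  partition (D :|: M) P ->
  [disjoint D & M] ->
  (#|D| <= k)%N ->
  (#|M| <= l)%N ->
  (forall X, X \in D -> subtree_disjoint T' X) ->
  (forall X, X \in M -> monotone_set s A X) ->
  (\sum_(X in D) #|X|)%N%:R <=
    potential w T P - potential w T' P + 2 * k%:R +
    (8 * k%:R + l%:R) * log2 (W / w s).
Proof.
move=> P A T' W w0 msa bT part dDM Dk Ml HD HM.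
have [bA rA] := msa T s bT.
have bT' : bst_on [set: 'I_n] T' by exact: bst_replace_path.
have rT' : root_key T' = Some s.
  by move: rA; rewrite /T' /A /replace_path; case: (alg T s).
set L := log2 _.
have L0 : 0 <= L := log2_total_weight_ge0 _ _ _ w0 s.
have XP X : X \in D :|: M -> X \subset P.
  by move=> XDM; rewrite -(cover_partition part); exact: bigcup_sup.
have split (F : 'I_n -> R) : \sum_(a in P) F a =
    \sum_(X in D) \sum_(a in X) F a + \sum_(X in M) \sum_(a in X) F a.
  rewrite (set_partition_big _ part) /= -bigU //.
  by apply: eq_bigl => X; rewrite !inE.
have sumD : (\sum_(X in D) #|X|)%N%:R <=
    \sum_(X in D) (potential w T X - potential w T' X) + #|D|%:R * (2 + 8 * L).
  rewrite natr_sum mulr_natl -sumr_const -big_split /=; apply: ler_sum => X XD.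
  rewrite addrA; apply: subtree_disjoint_card => //; last exact: HD.
  by apply: XP; rewrite inE XD.
(* The monotone parts contribute nothing to the left side of the claim; each may only raise the
   potential, by at most [L]. *)
have sumM : \sum_(X in M) (potential w T' X - potential w T X) <= #|M|%:R * L.
  rewrite mulr_natl -sumr_const; apply: ler_sum => X XM.
  apply: (monotone_potential _ _ _ w0 _ _ _ bT bT' rT' A (hanging T s)) => //.
    by apply: XP; rewrite inE XM orbT.
  exact: HM.
(* Passing from the cardinals to [k] and [l] relies on [L] being nonnegative. *)
have kD : #|D|%:R * (2 + 8 * L) <= k%:R * (2 + 8 * L).
  by rewrite ler_wpM2r ?ler_nat //; lra.
have lM : #|M|%:R * L <= l%:R * L by rewrite ler_wpM2r ?ler_nat.
move: sumD sumM kD lM; rewrite /potential !split !sumrB; lra.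
Qed.
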